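(* Suppose that there exists an integer $d>0$ such that there is no affine cube of dimension $d$ of distinct squares. Then there exist $\delta>0$ and $c>0$ such that $|A+A|\ge c\,|A|^{1+\delta}$ for every finite set $A$ of squares.
   Context: A square is the square of an integer. $A+A=\{x+y:x,y\in A\}$. An affine cube of dimension $d$ in $\mathbb{Z}$ is a set of integers of the form $\{b_0+\sum_{i\in I}b_i:\ I\subset\{1,\dots,d\}\}$ with non-zero integers $b_0,b_1,\dots,b_d$. It is an affine cube of distinct squares if the $2^d$ integers $b_0+\sum_{i\in I}b_i$ are pairwise distinct and are all squares. *)

(* Defs.v *)
From mathcomp Require Import all_boot all_order all_algebra.
From mathcomp Require Import finmap.

Set Implicit Arguments.
Unset Strict Implicit.
Unset Printing Implicit Defensive.

Import GRing.Theory.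
Local Open Scope fset_scope.
Local Open Scope ring_scope.

Definition is_square (x : int) : Prop := exists y : int, x = y ^+ 2.

Definition sumset (A B : {fset int}) : {fset int} :=
  [fset x + y | x in A, y in B].

(* b_1, ..., b_d are indexed by 'I_d, i.e. from 0. *)
Definition cube_point (d : nat) (b0 : int) (b : 'I_d -> int)
    (I : {set 'I_d}) : int :=
  b0 + \sum_(i in I) b i.

(* The base point, like the directions, is required to be non-zero. *)
Definition affine_cube (d : nat) (b0 : int) (b : 'I_d -> int)
    (C : {fset int}) : Prop :=
  [/\ b0 != 0, forall i : 'I_d, b i != 0
    & C = [fset cube_point b0 b I | I : {set 'I_d}]].

(* Distinctness concerns the family of the 2^d points indexed by the subsets I,
   hence the injectivity in I. *)
Definition affine_cube_of_distinct_squares (d : nat) (C : {fset int}) : Prop :=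
  exists (b0 : int) (b : 'I_d -> int),
    [/\ affine_cube b0 b C, injective (cube_point b0 b)
      & forall I : {set 'I_d}, is_square (cube_point b0 b I)].

(* Main.v *)
(** Let A be a set of n squares and D = |A - A|. Among the at most D
    differences, pigeonhole gives one, t, for which A_1 = A \cap (A - t) has
    at least about n^2 / D elements, and t can be chosen outside any given set
    of boundedly many values. As A_1 - A_1 lies in A - A, this can be repeated
    with the same D; after d steps the chosen differences t_1, ..., t_d have
    pairwise distinct subset sums, and every x in A_d is the base point of a
    d-dimensional cube inside A. In terms of u_i = |A_i| / 2D each step gives
    u_(i+1) >= u_i^2, so A_d is non-empty as soon as n^(2^d) exceeds a constant
    times D^(2^d - 1). If no such cube exists this fails, and Ruzsa's bound
    n D <= |A + A|^2 turns the failure into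
    n^(2K+1) <= C |A + A|^(2K) with K = 2^d - 1. *)
Require Import Defs.
From mathcomp Require Import all_boot all_order all_algebra.
From mathcomp Require Import finmap.
From mathcomp Require Import reals exp.
From mathcomp Require Import zify ring.

Set Implicit Arguments.
Unset Strict Implicit.
Unset Printing Implicit Defensive.

Import Order.TTheory GRing.Theory Num.Theory.
Local Open Scope ring_scope.

Lemma leq_exp2rW k m n : (m <= n)%N -> (m ^ k <= n ^ k)%N.
Proof. by case: k => // k le_mn; rewrite leq_exp2r. Qed.

(** * Sumsets, difference sets and popular differences *)

Definition diffset (A B : {fset int}) : {fset int} :=
  [fset x - y | x in A, y in B]%fset.

Lemma mem_sumset (A B : {fset int}) x y :
  x \in A -> y \in B -> x + y \in sumset A B.
Proof. by move=> xA yB; apply/imfset2P; exists x => //; exists y. Qed.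

Lemma sumsetS (A A' B B' : {fset int}) :
  (A `<=` A')%fset -> (B `<=` B')%fset -> (sumset A B `<=` sumset A' B')%fset.
Proof.
move=> /fsubsetP sA /fsubsetP sB.
apply/fsubsetP=> _ /imfset2P[x /= xA [y /= yB ->]].
by rewrite mem_sumset ?sA ?sB.
Qed.

Lemma mem_diffset (A B : {fset int}) x y :
  x \in A -> y \in B -> x - y \in diffset A B.
Proof. by move=> xA yB; apply/imfset2P; exists x => //; exists y. Qed.

Lemma diffsetS (A A' B B' : {fset int}) :
  (A `<=` A')%fset -> (B `<=` B')%fset ->
  (diffset A B `<=` diffset A' B')%fset.
Proof.
move=> /fsubsetP sA /fsubsetP sB.
apply/fsubsetP=> _ /imfset2P[x /= xA [y /= yB ->]].
by rewrite mem_diffset ?sA ?sB.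
Qed.

(** Fix one representation d = b - c of each difference. Then (a, d) goes to (a + b, a + c)
    injectively: the two coordinates differ by d, which determines b and hence a. *)
Lemma ruzsa_triangle (A B C : {fset int}) :
  (#|` A| * #|` diffset B C| <= #|` sumset A B| * #|` sumset A C|)%N.
Proof.
(* The default 0 is reached only for [d] outside [diffset B C]. *)
pose f d := head 0 [seq b <- enum_fset B | b - d \in C].
have fP d : d \in diffset B C -> f d \in B /\ f d - d \in C.
  move=> /imfset2P[b /= bB [c /= cC dE]].
  have : b \in [seq b <- enum_fset B | b - d \in C].
    by rewrite mem_filter dE opprB addrC subrK cC bB.
  rewrite /f; case sE: [seq _ <- _ | _] => [//|b' s] _ /=.
  by have := mem_head b' s; rewrite -sE mem_filter => /andP[].
pose g a d : int * int := (a + f d, a + (f d - d)).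
rewrite -(size_allpairs g A (diffset B C)).
rewrite -(size_allpairs pair (sumset A B) (sumset A C)); apply: uniq_leq_size.
  apply: allpairs_uniq; rewrite ?fset_uniq // => -[a d] [a' d'] _ _ [/= e1 e2].
  have ed : d = d' by lia.
  by congr (_, _) => //; move: e1; rewrite ed; lia.
move=> _ /allpairsP[[a d] /= [aA /fP[fB fC] ->]].
by apply/allpairsP; exists (g a d); rewrite !mem_sumset.
Qed.

(** Double counting: each x in [A] yields [#|] A|[differences y - x, at most]#|[B|] of them in [B].
    Some t outside [B] does at least as well as the average over the remaining differences. *)
Lemma popular_difference (A B : {fset int}) : (#|` B| < #|` A|)%N ->
  exists2 t : int, t \notin B &
    (#|` A| * (#|` A| - #|` B|) <=
     #|` diffset A A| * #|` [fset x in A | (x + t)%R \in A]%fset|)%N.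
Proof.
move=> ltBA; set N := (#|` A| * _)%N; pose X := (diffset A A `\` B)%fset.
pose r t := #|` [fset x in A | (x + t)%R \in A]%fset|.
have N_gt0 : (0 < N)%N by rewrite /N; lia.
have lbN : (N <= \sum_(t <- X) r t)%N.
  have rE t : r t = (\sum_(x <- A | (x + t)%R \in A) 1)%N.
    by rewrite /r card_fset_sum1 -big_fset_condE.
  under eq_bigr => t _ do rewrite rE big_mkcond.
  rewrite exchange_big /= /N {1}card_fset_sum1 big_distrl /=.
  rewrite big_seq [leqRHS]big_seq; apply: leq_sum => x xA.
  rewrite mul1n -big_mkcond big_fset_condE -card_fset_sum1.
  pose Ax := [fset (y - x)%R | y in A]%fset.
  have cAx : #|` Ax| = #|` A| by apply: card_imfset; exact: addIr.
  have : (#|` Ax| - #|` B| <= #|` (Ax `\` B)%fset|)%N.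
    by rewrite cardfsD leq_sub2l // fsubset_leq_card // fsubsetIr.
  rewrite cAx => /leq_trans; apply; apply/fsubset_leq_card/fsubsetP => t.
  rewrite !inE /= => /andP[-> /imfsetP[y /= yA ->]].
  by rewrite mem_diffset //= addrC subrK.
have [/hasP[t]|/hasPn small] :=
  boolP (has (fun t => N <= #|` diffset A A| * r t)%N X).
  by rewrite inE => /andP[tB _]; exists t.
suff : (#|` diffset A A| * N < #|` diffset A A| * N)%N by rewrite ltnn.
have X_gt0 : (0 < #|` X|)%N.
  move: lbN; rewrite lt0n; apply: contraTneq => /cardfs0_eq ->.
  by rewrite big_seq_fset0 -ltnNge.
(* If every t in [X] falls short of [N], it does so by at least 1. As [X] is non-empty, summing
   these integer gaps gives the strict inequality. *)
apply: (@leq_trans (\sum_(t <- X) (#|` diffset A A| * r t + 1))%N).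
  rewrite big_split /= -big_distrr -card_fset_sum1 /=.
  by apply: leq_ltn_trans (leq_mul (leqnn _) lbN) _; rewrite -addn1 leq_add2l.
apply: (@leq_trans (\sum_(t <- X) N)%N).
  rewrite big_seq [leqRHS]big_seq; apply: leq_sum => t /small.
  by rewrite -ltnNge addn1.
rewrite big_const_seq count_predT iter_addn_0 mulnC leq_mul2r.
by rewrite fsubset_leq_card ?fsubsetDl ?orbT.
Qed.

(** * Building a cube one direction at a time *)

Definition cons_dir n (t : int) (b : 'I_n -> int) (j : 'I_n.+1) : int :=
  oapp b t (unlift ord0 j).

Definition tail_set n (I : {set 'I_n.+1}) : {set 'I_n} :=
  [set j | lift ord0 j \in I].

Lemma cube_pointE n x (b : 'I_n -> int) I :
  cube_point x b I = x + cube_point 0 b I.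
Proof. by rewrite /cube_point add0r. Qed.

Lemma cube_point_cons n x t (b : 'I_n -> int) I :
  cube_point x (cons_dir t b) I =
  cube_point (x + (if ord0 \in I then t else 0)) b (tail_set I).
Proof.
rewrite /cube_point -addrA big_mkcond big_ord_recl /= [in RHS]big_mkcond /=.
congr (_ + (_ + _)); first by rewrite /cons_dir unlift_none.
by apply: eq_bigr => j _; rewrite inE /cons_dir liftK.
Qed.

Lemma tail_set_inj n (I J : {set 'I_n.+1}) :
  (ord0 \in I) = (ord0 \in J) -> tail_set I = tail_set J -> I = J.
Proof.
move=> e0 /setP et; apply/setP => j; case: (unliftP ord0 j) => [k|] -> //.
by have := et k; rewrite !inE.
Qed.

(** The forbidden values of a new direction t: the cube and its translate by t meet exactly when t
    is one of these. *)
Definition cube_differences n (b : 'I_n -> int) : {fset int} :=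
  [fset cube_point 0 b IJ.1 - cube_point 0 b IJ.2
    | IJ : {set 'I_n} * {set 'I_n}]%fset.

Lemma card_cube_differences n (b : 'I_n -> int) :
  (#|` cube_differences b| <= 4 ^ n)%N.
Proof.
apply: leq_trans (leq_imfset_card _ _ _) _.
rewrite -cardE card_prod -cardsT -powersetT card_powerset cardsT card_ord.
by rewrite -expnMn.
Qed.

Lemma cube_point_cons_inj n t (b : 'I_n -> int) :
  injective (cube_point 0 b) -> t \notin cube_differences b ->
  injective (cube_point 0 (cons_dir t b)).
Proof.
move=> inj_b tB I J; rewrite !cube_point_cons.
rewrite cube_pointE [RHS]cube_pointE => /eqP.
have nB X Y : t != cube_point 0 b X - cube_point 0 b Y.
  by apply: contraNneq tB => ->; apply/imfsetP; exists (X, Y).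
case: ifP => I0; case: ifP => J0 /eqP E.
- by apply: tail_set_inj; [rewrite I0 J0 | apply: inj_b; lia].
- by have /eqP[] := nB (tail_set J) (tail_set I); lia.
- by have /eqP[] := nB (tail_set I) (tail_set J); lia.
- by apply: tail_set_inj; [rewrite I0 J0 | apply: inj_b; lia].
Qed.

Lemma iterated_popular_difference (A : {fset int}) d :
  (0 < #|` A|)%N ->
  (2 * 4 ^ d * (2 * #|` diffset A A|) ^ (2 ^ d - 1) <= #|` A| ^ (2 ^ d))%N ->
  forall i, (i <= d)%N -> exists (b : 'I_i -> int) (A' : {fset int}),
    [/\ injective (cube_point 0 b),
        (A' `<=` A)%fset,
        forall x I, x \in A' -> cube_point x b I \in A
      & (#|` A| ^ (2 ^ i) <= #|` A'| * (2 * #|` diffset A A|) ^ (2 ^ i - 1))%N].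
Proof.
set n := #|` A|; set D := (2 * #|` diffset A A|)%N => n_gt0 large.
have D_gt0 : (0 < D)%N.
  have [x xA] : exists x, x \in A by apply/fset0Pn; rewrite -cardfs_gt0.
  rewrite muln_gt0 cardfs_gt0; apply/fset0Pn.
  by exists (x - x); exact: mem_diffset.
elim=> [_|i IH lt_id].
  exists (fun=> 0), A; split=> //; last by rewrite muln1.
  - by move=> I J _; apply/setP => -[].
  - by move=> x I xA; rewrite /cube_point big_pred0 ?addr0 // => -[].
have [b [A' [inj_b sA' bA' card_A']]] := IH (ltnW lt_id).
have expD j : (D ^ (2 ^ j.+1 - 1) = D * (D ^ (2 ^ j - 1) * D ^ (2 ^ j - 1)))%N.
  rewrite -expnD -expnS; congr (_ ^ _)%N; have := expn_gt0 2 j.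
  by rewrite expnS; lia.
have n_le_D : (n <= D)%N.
  have [x xA] : exists x, x \in A by apply/fset0Pn; rewrite -cardfs_gt0.
  have <- : #|` [fset y - x | y in A]%fset| = n.
    by apply: card_imfset; exact: addIr.
  apply: (@leq_trans #|` diffset A A|); last exact: leq_pmull.
  apply/fsubset_leq_card/fsubsetP.
  by move=> _ /imfsetP[y /= yA ->]; apply: mem_diffset.
(* Since n <= D, trading the missing 2^d - 2^i factors n for D turns the invariant at i into n^(2^d)
   <= |A'| D^(2^d - 1), to be compared with [large]. *)
have A'_large : (2 * 4 ^ d <= #|` A'|)%N.
  rewrite -(@leq_pmul2r (D ^ (2 ^ d - 1))) ?expn_gt0 ?D_gt0 //.
  apply: leq_trans large _.
  have le_2 : (2 ^ i <= 2 ^ d)%N by rewrite leq_exp2l // ltnW.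
  have gt_2 := expn_gt0 2 i.
  rewrite -{1}(subnKC le_2) expnD.
  apply: leq_trans (leq_mul card_A' (leq_exp2rW _ n_le_D)) _.
  by rewrite -mulnA -expnD leq_mul2l leq_pexp2l ?orbT //; lia.
have cB := card_cube_differences b.
have c4 : (4 ^ i <= 4 ^ d)%N by rewrite leq_exp2l // ltnW.
have c4_gt0 : (0 < 4 ^ d)%N by rewrite expn_gt0.
have [|t tB] := @popular_difference A' (cube_differences b); first by lia.
set A'' := [fset x in A' | _]%fset => popular.
exists (cons_dir t b), A''; split.
- exact: cube_point_cons_inj.
- by apply: fsubset_trans sA'; apply: fset_sub.
- move=> x I; rewrite inE /= => /andP[xA' xtA'].
  by rewrite cube_point_cons; case: ifP => _; rewrite ?addr0 bA'.
(* At most half of [A'] is lost to the forbidden values, and A' - A' lies in A - A. *)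
have sq : (#|` A'| * #|` A'| <= D * #|` A''|)%N.
  rewrite /D -mulnA.
  have := fsubset_leq_card (diffsetS sA' sA').
  nia.
rewrite expD expnSr expnM -mulnn.
apply: leq_trans (leq_mul card_A' card_A') _.
by rewrite mulnACA [leqRHS]mulnA [(_ * D)%N]mulnC leq_mul2r sq orbT.
Qed.

Lemma affine_cube_in (A : {fset int}) d : 0 \notin A -> (0 < #|` A|)%N ->
  (2 * 4 ^ d * (2 * #|` diffset A A|) ^ (2 ^ d - 1) <= #|` A| ^ (2 ^ d))%N ->
  exists (x : int) (b : 'I_d -> int),
    [/\ x != 0, forall i, b i != 0, injective (cube_point x b)
      & forall I, cube_point x b I \in A].
Proof.
move=> A0 A_gt0 large.
have [b [A' [inj_b sA' bA' card_A']]] :=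
  iterated_popular_difference A_gt0 large (leqnn d).
have [x xA'] : exists x, x \in A'.
  apply/fset0Pn; apply: contraTneq card_A' => ->.
  by rewrite cardfs0 mul0n -ltnNge expn_gt0 A_gt0.
exists x, b; split=> [|i|I J|I]; last exact: bA'.
- by apply: contraNneq A0 => <-; apply: (fsubsetP sA').
(* A zero direction would make the points of [[set i]] and [set0] coincide. *)
- apply/eqP => bi0; have /setP/(_ i) : [set i] = set0.
    by apply: inj_b; rewrite /cube_point big_set1 big_set0 bi0.
  by rewrite !inE eqxx.
- by rewrite cube_pointE [RHS]cube_pointE => /addrI /inj_b.
Qed.

(** * From the absence of cubes to growth of the sumset *)

Lemma sumset_lower_bound d :
  ~ (exists C : {fset int}, affine_cube_of_distinct_squares d C) ->
  exists2 C : nat, (0 < C)%N &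
    forall A : {fset int}, (forall x : int, x \in A -> is_square x) ->
    (#|` A| ^ (2 * (2 ^ d - 1) + 1) <=
     C * #|` sumset A A| ^ (2 * (2 ^ d - 1)))%N.
Proof.
move=> no_cube; set K := (2 ^ d - 1)%N.
have dE : (2 ^ d = K.+1)%N by have := expn_gt0 2 d; rewrite /K; lia.
pose C0 := (2 * 4 ^ d * 2 ^ K)%N.
(* [C0] collects the constants of the failed size hypothesis; the power of 2 pays for n <= 2 n' when
   0 is put back. *)
exists (2 ^ (2 * K + 1) * C0)%N => [|A sqA].
  by rewrite !muln_gt0 !expn_gt0.
(* 0 is removed because the base point of a cube has to be non-zero. *)
pose A' := (A `\ 0%R)%fset.
set n := #|` A|; set S := #|` sumset A A|; set n' := #|` A'|.
have A'_bound : (n' ^ (2 * K + 1) <= C0 * S ^ (2 * K))%N.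
  have [->|n'_gt0] := posnP n'; first by rewrite addn1 exp0n.
  have small : (n' ^ (2 ^ d) <= 2 * 4 ^ d * (2 * #|` diffset A' A'|) ^ K)%N.
    rewrite leqNgt; apply/negP => /ltnW large; apply: no_cube.
    have [||x [b [x0 b0 inj_b bA']]] := @affine_cube_in A' d _ _ large => //.
      by rewrite !inE eqxx.
    exists [fset cube_point x b I | I : {set 'I_d}]%fset, x, b; split=> // I.
    by apply: sqA; move: (bA' I); rewrite !inE => /andP[].
  have ruzsa : (n' * #|` diffset A' A'| <= S * S)%N.
    apply: leq_trans (ruzsa_triangle A' A' A') _.
    by rewrite leq_mul // fsubset_leq_card // sumsetS // fsubD1set.
  (* The extra factor n'^K pairs with |A' - A'|^K, so that the K-th power of [ruzsa] applies. *)
  have -> : (2 * K + 1 = K + 2 ^ d)%N by rewrite dE; lia.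
  rewrite expnD (leq_trans (leq_mul (leqnn _) small)) //.
  rewrite /C0 expnMn expnM -mulnn.
  have -> : (n' ^ K * (2 * 4 ^ d * (2 ^ K * #|` diffset A' A'| ^ K)) =
      2 * 4 ^ d * 2 ^ K * (n' * #|` diffset A' A'|) ^ K)%N.
    by rewrite expnMn; ring.
  by rewrite leq_mul2l leq_exp2rW ?orbT.
have le_nn' : (n <= n' + 1)%N.
  by rewrite /n (cardfsD1 0%R A) -/n' addnC leq_add2l leq_b1.
(* For A = {0} the bound n <= 2 n' fails, so sets without non-zero elements are treated directly. *)
have [n'0|n'_gt0] := posnP n'.
  have [n0|n_gt0] := posnP n; first by rewrite n0 addn1 exp0n.
  have -> : n = 1%N by lia.
  have [x xA] : exists x, x \in A by apply/fset0Pn; rewrite -cardfs_gt0.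
  have S_gt0 : (0 < S)%N.
    by rewrite cardfs_gt0; apply/fset0Pn; exists (x + x); apply: mem_sumset.
  by rewrite exp1n !muln_gt0 !expn_gt0 S_gt0.
have le_n2 : (n <= 2 * n')%N by lia.
rewrite -mulnA (leq_trans (leq_exp2rW _ le_n2)) // expnMn.
by rewrite leq_mul2l A'_bound orbT.
Qed.

Theorem theorem5 (R : realType)
  (hcube : exists d : nat, (0 < d)%N /\
     ~ (exists C : {fset int}, affine_cube_of_distinct_squares d C)) :
  exists delta c : R, [/\ 0 < delta, 0 < c &
    forall A : {fset int}, (forall x : int, x \in A -> is_square x) ->
      c * (#|` A|%:R `^ (1 + delta)) <= #|` sumset A A|%:R].
Proof.
have [d [d_gt0 /sumset_lower_bound[C C_gt0 bound]]] := hcube.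
pose m := (2 * (2 ^ d - 1))%N.
have m_gt0 : (0 < m)%N by have := @leq_exp2l 2 1 d isT; rewrite /m; lia.
have m_neq0 : m%:R != 0 :> R by rewrite pnatr_eq0 -lt0n.
(* Taking m-th roots in n^(m+1) <= C |A + A|^m gives the exponent 1 + 1/m and the constant
   C^(-1/m). *)
exists m%:R^-1, ((C%:R `^ m%:R^-1)^-1); split=> [||A sqA].
- by rewrite invr_gt0 ltr0n.
- by rewrite invr_gt0 powR_gt0 // ltr0n.
rewrite ler_pdivrMl ?powR_gt0 ?ltr0n //.
have -> : 1 + m%:R^-1 = (m + 1)%:R * m%:R^-1 :> R by rewrite natrD; field.
have root k : k%:R = (k ^ m)%:R `^ m%:R^-1 :> R.
  by rewrite natrX -powR_mulrn // -powRrM mulfV // powRr1.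
rewrite [#|` sumset A A|%:R]root -powRM // -natrM powRrM powR_mulrn // -natrX.
by rewrite ge0_ler_powR ?nnegrE ?invr_ge0 ?ler0n // ler_nat bound.
Qed.
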